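(* Let $\{X_{ij} : j\ge i\ge 1\}$ be a collection of i.i.d. real random variables with $\mathbb{E}X_{12}=m$ and $\mathbb{E}X_{12}^4<\infty$, and let $\mathbf{M}_n$ be the associated $n\times n$ symmetric Markov matrix. Then $$\lim_{n\to\infty}\frac{\|\mathbf{M}_n\|}{n}=|m|\qquad\text{almost surely.}$$
   Context: Markov matrix: put $X_{ji}=X_{ij}$ for $j>i\ge1$, $\mathbf{X}_n=[X_{ij}]_{1\le i,j\le n}$, $\mathbf{D}_n=\mathrm{diag}\big(\sum_{j=1}^nX_{ij}\big)_{1\le i\le n}$ and $\mathbf{M}_n=\mathbf{X}_n-\mathbf{D}_n$; thus each row of $\mathbf{M}_n$ sums to zero (and the values $X_{ii}$ are irrelevant). $\|\mathbf{M}_n\|$ is the spectral norm, i.e. the largest absolute value of the eigenvalues of the symmetric matrix $\mathbf{M}_n$. *)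

(* Defs.v *)
From HB Require Import structures.
From mathcomp Require Import all_boot all_order all_algebra.
From mathcomp Require Import all_classical all_reals all_analysis.

Set Implicit Arguments.
Unset Strict Implicit.
Unset Printing Implicit Defensive.

Import Order.TTheory GRing.Theory Num.Theory.
Import numFieldNormedType.Exports.

Local Open Scope classical_set_scope.
Local Open Scope ring_scope.

Definition mutually_independent (R : realType) (d : measure_display)
    (T : measurableType d) (P : probability T R) (I : eqType) (D : set I)
    (X : I -> {RV P >-> R}) : Prop :=
  forall (J : seq I) (B : I -> set R), uniq J -> [set` J] `<=` D ->
    (forall i, measurable (B i)) ->
    P (\bigcap_(i in [set` J]) (X i @^-1` B i)) =
      (\prod_(i <- J) P (X i @^-1` B i))%E.

Definition identically_distributed (R : realType) (d : measure_display)
    (T : measurableType d) (P : probability T R) (I : eqType) (D : set I)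
    (X : I -> {RV P >-> R}) : Prop :=
  forall i j, D i -> D j -> forall B : set R, measurable B ->
    distribution P (X i) B = distribution P (X j) B.

Definition iid (R : realType) (d : measure_display)
    (T : measurableType d) (P : probability T R) (I : eqType) (D : set I)
    (X : I -> {RV P >-> R}) : Prop :=
  mutually_independent D X /\ identically_distributed D X.

(* Only the entries of x with i <= j are used. Indices start at 0, so x i j
   plays the role of the entry written X_{i+1,j+1} with 1-based indices. *)
Definition symmetric_mx (R : realType) (x : nat -> nat -> R) (n : nat) :
    'M[R]_n :=
  \matrix_(i, j) x (minn i j) (maxn i j).

Definition row_sum_diag (R : realType) (n : nat) (A : 'M[R]_n) : 'M[R]_n :=
  diag_mx (\row_i \sum_j A i j).

Definition markov_mx (R : realType) (x : nat -> nat -> R) (n : nat) :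
    'M[R]_n :=
  symmetric_mx x n - row_sum_diag (symmetric_mx x n).

(* For a symmetric A with n > 0, the set below is finite and nonempty, so the
   supremum is a maximum; for n = 0 it is empty and the value is 0. This is the
   spectral norm only for symmetric A. *)
Definition spectral_norm (R : realType) (n : nat) (A : 'M[R]_n) : R :=
  sup [set `|a| | a in [set a : R | eigenvalue A a]].

(* Main.v *)
Require Import Defs.
From mathcomp Require Import all_boot all_order all_algebra.
From mathcomp Require Import all_classical all_reals all_analysis.
From mathcomp Require Import measurable_realfun.
From mathcomp Require Import ring lra zify.
Import Order.TTheory GRing.Theory Num.Theory.
Import numFieldNormedType.Exports.
Local Open Scope classical_set_scope.
Local Open Scope ring_scope.

Set Implicit Arguments.
Unset Strict Implicit.

(** Write X_ij = m + Y_ij. The Markov matrix of the constant matrix m is m times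
    (J - n I), whose norm is |m| n, so it suffices that the Markov matrix of Y
    has norm o(n) almost surely. Its quadratic form at v differs from the one of
    Y by the sum of the v_i^2 times the i-th row sum of Y. The norm of Y is at
    most the fourth root of ||Y^2||_F^2, and both this quantity and the sum of
    the fourth powers of the n row sums have mean O(n^3), since the mean of a
    product of four entries vanishes when one of them occurs only once. Dividing
    by n^4 gives means O(1/n), which are summable along the subsequence
    n = (k+1)^2. Between consecutive squares the norm of Y is monotone in n, as
    Y_n is a principal submatrix, and the row sums change by at most 2k+1 terms,
    which are controlled by the fourth moments alone. *)

(** * Eigenvalues and quadratic forms of symmetric matrices *)

Definition qform (R : realType) n (A : 'M[R]_n) (x : 'rV[R]_n) : R :=
  \sum_i \sum_j x 0 i * A i j * x 0 j.

Definition sqnorm (R : realType) n (x : 'rV[R]_n) : R := \sum_i x 0 i ^+ 2.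

Lemma qformE (R : realType) n (A : 'M[R]_n) (x : 'rV[R]_n) :
  qform A x = (x *m A *m x^T) 0 0.
Proof.
rewrite /qform !mxE exchange_big; apply: eq_bigr => j _.
by rewrite !mxE mulr_suml.
Qed.

Lemma sqnormE (R : realType) n (x : 'rV[R]_n) : sqnorm x = (x *m x^T) 0 0.
Proof. by rewrite mxE; apply: eq_bigr => i _; rewrite mxE expr2. Qed.

Lemma sqnorm_ge0 (R : realType) n (x : 'rV[R]_n) : 0 <= sqnorm x.
Proof. by apply: sumr_ge0 => i _; exact: sqr_ge0. Qed.

Lemma sqnorm_eq0 (R : realType) n (x : 'rV[R]_n) : (sqnorm x == 0) = (x == 0).
Proof.
apply/eqP/eqP => [|->]; last first.
  by rewrite /sqnorm big1// => i _; rewrite mxE expr0n.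
move/eqP; rewrite psumr_eq0 => [/allP x0|i _]; last exact: sqr_ge0.
apply/rowP => i; rewrite mxE; apply/eqP; rewrite -sqrf_eq0.
by apply: x0; rewrite mem_index_enum.
Qed.

Lemma sqnormZ (R : realType) n (c : R) (x : 'rV[R]_n) :
  sqnorm (c *: x) = c ^+ 2 * sqnorm x.
Proof. by rewrite /sqnorm mulr_sumr; apply: eq_bigr => i _; rewrite mxE exprMn. Qed.

Lemma qformZ (R : realType) n (A : 'M[R]_n) (c : R) (x : 'rV[R]_n) :
  qform A (c *: x) = c ^+ 2 * qform A x.
Proof.
rewrite /qform mulr_sumr; apply: eq_bigr => i _.
by rewrite mulr_sumr; apply: eq_bigr => j _; rewrite !mxE; ring.
Qed.

Lemma qformN (R : realType) n (A : 'M[R]_n) (x : 'rV[R]_n) :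
  qform (- A) x = - qform A x.
Proof. by rewrite !qformE mulmxN mulNmx mxE. Qed.

Lemma qform_eigen (R : realType) n (A : 'M[R]_n) (a : R) (x : 'rV[R]_n) :
  x *m A = a *: x -> qform A x = a * sqnorm x.
Proof. by move=> xA; rewrite qformE xA -scalemxAl mxE sqnormE. Qed.

Lemma continuous_sqnorm (R : realType) n : continuous (@sqnorm R n).
Proof.
apply: continuous_big => [|i _ x]; first exact: add_continuous.
by have c := @coord_continuous R 1 n 0 i x; exact: (cvgM c c).
Qed.

Lemma continuous_qform (R : realType) n (A : 'M[R]_n) : continuous (qform A).
Proof.
apply: continuous_big => [|i _]; first exact: add_continuous.
apply: continuous_big => [|j _ x]; first exact: add_continuous.
have ci := @coord_continuous R 1 n 0 i x.
have cj := @coord_continuous R 1 n 0 j x.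
by apply: (cvgM _ cj); apply: (cvgM ci); exact: cvg_cst.
Qed.

Lemma compact_unit_sphere (R : realType) n :
  compact [set x : 'rV[R]_n | sqnorm x = 1].
Proof.
apply: bounded_closed_compact.
  exists 1; split; first exact: num_real.
  move=> b b1 x /= x1; rewrite [leLHS]mx_normrE; apply: (le_trans _ (ltW b1)).
  apply/bigmax_leP; split => // -[i j] _ /=.
  rewrite ord1 -(@ler_pXn2r _ 2)// ?nnegrE// expr1n -x1 real_normK ?num_real//.
  rewrite /sqnorm (bigD1 j)//= lerDl.
  by apply: sumr_ge0 => k _; exact: sqr_ge0.
have -> : [set x : 'rV[R]_n | sqnorm x = 1] = @sqnorm R n @^-1` [set y | y = 1] by [].
by apply: preimage_closed; [move=> x _; exact: continuous_sqnorm | exact: closed_eq].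
Qed.

(* The maximum of the form on the unit sphere is an eigenvalue: at a maximiser
   x0 the form of B = c - A is nonnegative and vanishes, so its derivative in
   the direction x0 B, which is |x0 B|^2 up to a factor 2, vanishes. *)
Lemma max_eigenvalue (R : realType) n (A : 'M[R]_n.+1) : A^T = A ->
  exists2 c, eigenvalue A c & forall x, qform A x <= c * sqnorm x.
Proof.
move=> symA.
have [||x0] := @EVT_max_rV R _ (qform A) _ _ (@compact_unit_sphere R n.+1).
- exists (delta_mx 0 0) => /=; rewrite /sqnorm (bigD1 0)//= mxE !eqxx expr1n.
  by rewrite big1 ?addr0// => i /negbTE i0; rewrite mxE i0 andbF expr0n.
- by apply: continuous_subspaceT; exact: continuous_qform.
rewrite inE/= => x01 x0max.
have x0N : x0 != 0 by rewrite -sqnorm_eq0 x01 oner_eq0.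
pose c := qform A x0.
(* Both sides are homogeneous of degree 2, so the bound on the sphere extends to every [x] after
   normalisation. *)
have le_c x : qform A x <= c * sqnorm x.
  have [->|xN] := eqVneq x 0.
    by rewrite -[0](scale0r 0) qformZ sqnormZ expr0n !mul0r mulr0.
  have sx : 0 < sqnorm x by rewrite lt_def sqnorm_eq0 xN sqnorm_ge0.
  have := x0max ((Num.sqrt (sqnorm x))^-1 *: x).
  rewrite inE/= sqnormZ qformZ exprVn sqr_sqrtr ?sqnorm_ge0//.
  rewrite mulVf ?gt_eqF// => /(_ erefl).
  by rewrite mulrC ler_pdivrMr.
exists c => //.
have [B BE] : exists B, B = c%:M - A by exists (c%:M - A).
have qB x : qform B x = c * sqnorm x - qform A x.
  by rewrite BE !qformE sqnormE mulmxBr mulmxBl mul_mx_scalar -scalemxAl !mxE.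
have symB : B^T = B by rewrite BE linearB/= tr_scalar_mx symA.
pose y := x0 *m B.
(* The constant term vanishes since [x0] attains the value [c], and by symmetry of [B] each of the
   two cross terms is [t * sqnorm y]. *)
have expand t : qform B (x0 + t *: y) = t * (2 * sqnorm y) + t ^+ 2 * qform B y.
  have qB0 : (x0 *m B *m x0^T) 0 0 = 0.
    by rewrite -qformE qB x01 mulr1 subrr.
  have yBx : y *m B *m x0^T = y *m y^T by rewrite /y trmx_mul symB !mulmxA.
  have -> : qform B (x0 + t *: y) =
      ((x0 + t *: y) *m B *m (x0^T + t *: y^T)) 0 0.
    by rewrite qformE; congr ((_ *m _) 0 0); apply/matrixP => i j; rewrite !mxE.
  rewrite qformE sqnormE mulmxDl mulmxDl !mulmxDr.
  rewrite -!scalemxAl -!scalemxAr yBx.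
  have -> : x0 *m B *m y^T = y *m y^T by [].
  move: (x0 *m B *m x0^T) (y *m y^T) (y *m B *m y^T) qB0 => u v w u0.
  by rewrite !mxE u0; ring.
have yg : 0 <= qform B y by rewrite qB subr_ge0.
have y0 : 0 <= sqnorm y := sqnorm_ge0 y.
have : sqnorm y = 0.
  (* The step [t = - b / (g + 1)] makes the form equal to minus [b ^+ 2] times a positive factor, so
     nonnegativity forces [b = 0]. The [+ 1] keeps the denominator positive when [g = 0]. *)
  have := le_c (x0 + (- (sqnorm y / (qform B y + 1))) *: y).
  rewrite -subr_ge0 -qB expand.
  set g := qform B y in yg *; set b := sqnorm y in y0 *.
  have -> : - (b / (g + 1)) * (2 * b) + (- (b / (g + 1))) ^+ 2 * g =
            - (b ^+ 2 * (g + 2)) / (g + 1) ^+ 2 by field; apply/eqP; lra.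
  rewrite pmulr_lge0 ?invr_gt0 ?exprn_gt0//; last by lra.
  rewrite oppr_ge0 pmulr_lle0; last by lra.
  by move=> b2; apply/eqP; rewrite -sqrf_eq0 eq_le b2 sqr_ge0.
move/eqP; rewrite sqnorm_eq0 => /eqP yE.
apply/eigenvalueP; exists x0 => //; apply/eqP.
by rewrite eq_sym -subr_eq0 -mul_mx_scalar -mulmxBr -BE; apply/eqP.
Qed.

Lemma eigenvalue_le (R : realType) n (A : 'M[R]_n) (b : R) :
  (forall x, `|qform A x| <= b * sqnorm x) ->
  forall a, eigenvalue A a -> `|a| <= b.
Proof.
move=> bA a /eigenvalueP[x xA xN].
have sx : 0 < sqnorm x by rewrite lt_def sqnorm_eq0 xN sqnorm_ge0.
have := bA x; rewrite (qform_eigen xA) normrM (ger0_norm (sqnorm_ge0 x)).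
by rewrite ler_pM2r.
Qed.

Lemma spectral_norm_le (R : realType) n (A : 'M[R]_n.+1) (b : R) : A^T = A ->
  (forall x, `|qform A x| <= b * sqnorm x) -> spectral_norm A <= b.
Proof.
move=> symA bA; apply: ge_sup.
  by have [c cA _] := max_eigenvalue symA; exists `|c|, c.
by move=> _ [a /= aA <-]; exact: eigenvalue_le bA a aA.
Qed.

(** [sup] is an upper bound only of a bounded set; the bound on the form is what bounds the
    eigenvalues. *)
Lemma eigenvalue_norm_le (R : realType) n (A : 'M[R]_n) (b a : R) :
  (forall x, `|qform A x| <= b * sqnorm x) -> eigenvalue A a ->
  `|a| <= spectral_norm A.
Proof.
move=> bA aA; apply: ub_le_sup; last by exists a.
by exists b => _ [c /= cA <-]; exact: eigenvalue_le bA c cA.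
Qed.

(** The largest eigenvalues of [A] and of [- A] bound the form from above and from below. *)
Lemma qform_le_spectral_norm (R : realType) n (A : 'M[R]_n.+1) (b : R) :
  A^T = A -> (forall x, `|qform A x| <= b * sqnorm x) ->
  forall x, `|qform A x| <= spectral_norm A * sqnorm x.
Proof.
move=> symA bA x.
have [c cA lec] := max_eigenvalue symA.
have [|e eA lee] := @max_eigenvalue R n (- A); first by rewrite linearN/= symA.
have eA' : eigenvalue A (- e).
  move/eigenvalueP: eA => [v vA vN]; apply/eigenvalueP; exists v => //.
  by rewrite scaleNr -vA mulmxN opprK.
have cs := eigenvalue_norm_le bA cA; have es := eigenvalue_norm_le bA eA'.
rewrite normrN in es.
rewrite ler_norml; apply/andP; split.
  rewrite lerNl -qformN; apply: le_trans (lee x) _.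
  by rewrite ler_wpM2r ?sqnorm_ge0// (le_trans (ler_norm _)).
apply: le_trans (lec x) _.
by rewrite ler_wpM2r ?sqnorm_ge0// (le_trans (ler_norm _)).
Qed.

(** * The quadratic form of a Markov matrix *)

(** Lagrange's identity: the double sum of the squares [(a i * b j - a j * b i) ^+ 2] is twice the
    gap between the two sides. *)
Lemma cauchy_schwarz_sum (R : realFieldType) I (r : seq I) (a b : I -> R) :
  (\sum_(i <- r) a i * b i) ^+ 2 <=
  (\sum_(i <- r) a i ^+ 2) * (\sum_(i <- r) b i ^+ 2).
Proof.
have : 0 <= \sum_(i <- r) \sum_(j <- r) (a i * b j - a j * b i) ^+ 2.
  by apply: sumr_ge0 => i _; apply: sumr_ge0 => j _; exact: sqr_ge0.
have -> : \sum_(i <- r) \sum_(j <- r) (a i * b j - a j * b i) ^+ 2 =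
    2 * ((\sum_(i <- r) a i ^+ 2) * (\sum_(i <- r) b i ^+ 2) -
         (\sum_(i <- r) a i * b i) ^+ 2).
  transitivity (\sum_(i <- r) (a i ^+ 2 * (\sum_(j <- r) b j ^+ 2) +
      b i ^+ 2 * (\sum_(j <- r) a j ^+ 2)
      - 2 * (a i * b i) * (\sum_(j <- r) a j * b j))).
    apply: eq_bigr => i _; rewrite !mulr_sumr -sumrN -!big_split/=.
    by apply: eq_bigr => j _; ring.
  by rewrite !big_split/= -!mulr_suml sumrN -!mulr_suml -mulr_sumr; ring.
by rewrite pmulr_rge0// subr_ge0.
Qed.

(** Cauchy-Schwarz against the constant 1, applied to [a] and then to its squares. *)
Lemma sum_pow4_le (R : realFieldType) I (r : seq I) (a : I -> R) :
  (\sum_(i <- r) a i) ^+ 4 <= (size r)%:R ^+ 3 * \sum_(i <- r) a i ^+ 4.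
Proof.
have cs (b : I -> R) :
    (\sum_(i <- r) b i) ^+ 2 <= (size r)%:R * \sum_(i <- r) b i ^+ 2.
  have := cauchy_schwarz_sum r b (fun=> 1).
  under eq_bigr do rewrite mulr1.
  rewrite mulrC; congr (_ <= _ * _).
  by rewrite expr1n big_const_seq count_predT iter_addr_0.
have := cs a; have := cs (fun i => a i ^+ 2).
have -> : \sum_(i <- r) (a i ^+ 2) ^+ 2 = \sum_(i <- r) a i ^+ 4.
  by apply: eq_bigr => i _; rewrite -exprM.
have : 0 <= (\sum_(i <- r) a i) ^+ 2 := sqr_ge0 _.
have : 0 <= \sum_(i <- r) a i ^+ 2 by apply: sumr_ge0 => i _; exact: sqr_ge0.
move: (\sum_(i <- r) a i) (\sum_(i <- r) a i ^+ 2) (\sum_(i <- r) a i ^+ 4).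
move=> s1 s2 s4 s20 s1s s24 s12; rewrite (exprM _ 2 2).
have n0 : 0 <= (size r)%:R :> R by [].
apply: le_trans (_ : ((size r)%:R * s2) ^+ 2 <= _).
  by rewrite ler_pXn2r// nnegrE mulr_ge0.
rewrite exprMn [_ ^+ 3]exprSr -mulrA.
by rewrite ler_wpM2l// sqr_ge0.
Qed.

Lemma sqnorm_row_sum (R : realType) n (x : 'rV[R]_n) :
  (\sum_i x 0 i) ^+ 2 <= n%:R * sqnorm x.
Proof.
have := cauchy_schwarz_sum (index_enum 'I_n) (fun i => x 0 i) (fun=> 1).
under eq_bigr do rewrite mulr1.
by rewrite mulrC expr1n sumr_const card_ord.
Qed.

(** The squared Frobenius norm of Y^T Y, which is that of Y^2 when Y is symmetric. The inner sum
    runs over the paths from [j] to [l] through [i]. *)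
Definition wedge_sum (R : realType) (y : nat -> nat -> R) (n : nat) : R :=
  \sum_(j < n) \sum_(l < n) (\sum_(i < n) y i j * y i l) ^+ 2.

(** Two uses of Cauchy-Schwarz: the square of the form is at most |f|^2 |Yf|^2, and |Yf|^2 is the
    Frobenius product of Y^T Y with f f^T. *)
Lemma pow4_bilinear_le (R : realType) (y : nat -> nat -> R) (f : nat -> R) n :
  (\sum_(i < n) \sum_(j < n) f i * y i j * f j) ^+ 4 <=
  wedge_sum y n * (\sum_(i < n) f i ^+ 2) ^+ 4.
Proof.
set s := \sum_(i < n) f i ^+ 2.
have s0 : 0 <= s by apply: sumr_ge0 => i _; exact: sqr_ge0.
pose z (i : nat) := \sum_(j < n) y i j * f j.
pose t := \sum_(i < n) z i ^+ 2.
have t0 : 0 <= t by apply: sumr_ge0 => i _; exact: sqr_ge0.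
have q_le : (\sum_(i < n) \sum_(j < n) f i * y i j * f j) ^+ 2 <= s * t.
  have -> : \sum_(i < n) \sum_(j < n) f i * y i j * f j = \sum_(i < n) f i * z i.
    apply: eq_bigr => i _; rewrite mulr_sumr; apply: eq_bigr => j _.
    by rewrite mulrA.
  exact: cauchy_schwarz_sum.
have tE : t = \sum_(p : 'I_n * 'I_n)
    (\sum_(i < n) y i p.1 * y i p.2) * (f p.1 * f p.2).
  rewrite -(pair_bigA _ (fun j l : 'I_n =>
    (\sum_(i < n) y i j * y i l) * (f j * f l)))/=.
  transitivity (\sum_(i < n) \sum_(j < n) \sum_(l < n) y i j * f j * (y i l * f l)).
    apply: eq_bigr => i _; rewrite expr2 /z mulr_suml.
    by apply: eq_bigr => j _; rewrite mulr_sumr.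
  rewrite exchange_big/=; apply: eq_bigr => j _.
  rewrite exchange_big/=; apply: eq_bigr => l _.
  by rewrite mulr_suml; apply: eq_bigr => i _; ring.
have sE : \sum_(p : 'I_n * 'I_n) (f p.1 * f p.2) ^+ 2 = s ^+ 2.
  rewrite -(pair_bigA _ (fun j l : 'I_n => (f j * f l) ^+ 2))/= expr2 mulr_suml.
  by apply: eq_bigr => j _; rewrite mulr_sumr; apply: eq_bigr => l _; rewrite exprMn.
have t_le : t ^+ 2 <= wedge_sum y n * s ^+ 2.
  rewrite tE -sE /wedge_sum.
  rewrite (pair_bigA _ (fun j l : 'I_n => (\sum_(i < n) y i j * y i l) ^+ 2))/=.
  exact: cauchy_schwarz_sum.
rewrite (exprM _ 2 2); apply: le_trans (_ : (s * t) ^+ 2 <= _).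
  by rewrite ler_pXn2r// nnegrE ?sqr_ge0 ?mulr_ge0.
have -> : wedge_sum y n * s ^+ 4 = wedge_sum y n * s ^+ 2 * s ^+ 2 by ring.
by rewrite exprMn mulrC ler_wpM2r ?sqr_ge0.
Qed.

Lemma big_ord_widen0 (R : realType) (n N : nat) (F : nat -> R) : (n <= N)%N ->
  (forall i, (n <= i)%N -> F i = 0) -> \sum_(i < n) F i = \sum_(i < N) F i.
Proof.
move=> nN F0; rewrite (big_ord_widen _ _ nN).
rewrite [RHS](bigID (fun i : 'I_N => (i < n)%N))/=.
by rewrite [X in _ = _ + X]big1 ?addr0// => i; rewrite -leqNgt => /F0.
Qed.

(* The quadratic form of a principal submatrix is a restriction of the form of
   the whole matrix, so the bound for size N also applies to smaller sizes. *)
Lemma pow4_qform_le (R : realType) (y : nat -> nat -> R) (n N : nat)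
    (v : 'rV[R]_n) : (n <= N)%N ->
  qform (\matrix_(i, j) y i j) v ^+ 4 <= wedge_sum y N * sqnorm v ^+ 4.
Proof.
move=> nN; pose f (k : nat) := if insub k is Some i then v 0 i else 0.
have fE (i : 'I_n) : f i = v 0 i by rewrite /f valK.
have f0 i : (n <= i)%N -> f i = 0 by move=> ni; rewrite /f insubF// ltnNge ni.
have -> : sqnorm v = \sum_(i < N) f i ^+ 2.
  rewrite -(@big_ord_widen0 _ n N (fun i => f i ^+ 2))//.
    by apply: eq_bigr => i _; rewrite fE.
  by move=> i /f0 ->; rewrite expr0n.
have -> : qform (\matrix_(i, j) y i j) v =
    \sum_(i < N) \sum_(j < N) f i * y i j * f j.
  rewrite -(@big_ord_widen0 _ n N (fun i => \sum_(j < N) f i * y i j * f j))//.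
    apply: eq_bigr => i _.
    rewrite -(@big_ord_widen0 _ n N (fun j => f i * y i j * f j))//.
      by apply: eq_bigr => j _; rewrite !mxE !fE.
    by move=> j /f0 ->; rewrite mulr0.
  by move=> i /f0 ->; rewrite big1// => j _; rewrite !mul0r.
exact: pow4_bilinear_le.
Qed.

Lemma qform_row_sum_diag (R : realType) n (A : 'M[R]_n) (v : 'rV[R]_n) :
  qform (A - row_sum_diag A) v =
  qform A v - \sum_i v 0 i ^+ 2 * \sum_j A i j.
Proof.
rewrite /qform -sumrB; apply: eq_bigr => i _.
transitivity (\sum_j (v 0 i * A i j * v 0 j) -
    \sum_j v 0 i * row_sum_diag A i j * v 0 j).
  by rewrite -sumrB; apply: eq_bigr => j _; rewrite !mxE; ring.
congr (_ - _); rewrite (bigD1 i)//= big1 => [|j ji].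
  by rewrite !mxE eqxx mulr1n addr0; ring.
by rewrite !mxE (eq_sym i) (negbTE ji) mulr0n; ring.
Qed.

Definition sym_dev (R : realType) (x : nat -> nat -> R) (m : R) (i j : nat) : R :=
  x (minn i j) (maxn i j) - m.

(** The quadratic form of the Markov matrix of the deviations Y. *)
Definition dev_form (R : realType) (x : nat -> nat -> R) (m : R) n
    (v : 'rV[R]_n) : R :=
  qform (\matrix_(i, j) sym_dev x m i j) v -
  \sum_i v 0 i ^+ 2 * \sum_(j < n) sym_dev x m i j.

Lemma qform_markov (R : realType) (x : nat -> nat -> R) (m : R) n
    (v : 'rV[R]_n) :
  qform (markov_mx x n) v =
  m * ((\sum_i v 0 i) ^+ 2 - n%:R * sqnorm v) + dev_form x m v.
Proof.
rewrite /markov_mx qform_row_sum_diag /dev_form.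
have -> : qform (symmetric_mx x n) v =
    m * (\sum_i v 0 i) ^+ 2 + qform (\matrix_(i, j) sym_dev x m i j) v.
  rewrite expr2 mulr_suml mulr_sumr /qform -big_split/=; apply: eq_bigr => i _.
  rewrite !mulr_sumr -big_split/=; apply: eq_bigr => j _.
  by rewrite !mxE /sym_dev; ring.
have -> : \sum_i v 0 i ^+ 2 * \sum_j symmetric_mx x n i j =
    m * (n%:R * sqnorm v) + \sum_i v 0 i ^+ 2 * \sum_(j < n) sym_dev x m i j.
  rewrite /sqnorm !mulr_sumr -big_split/=; apply: eq_bigr => i _.
  have -> : \sum_j symmetric_mx x n i j = n%:R * m + \sum_(j < n) sym_dev x m i j.
    have -> : n%:R * m = \sum_(j < n) m by rewrite sumr_const card_ord mulr_natl.
    by rewrite -big_split/=; apply: eq_bigr => j _; rewrite !mxE /sym_dev; ring.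
  by ring.
by ring.
Qed.

Lemma markov_mx_sym (R : realType) (x : nat -> nat -> R) n :
  (markov_mx x n)^T = markov_mx x n.
Proof.
apply/matrixP => i j; rewrite !mxE minnC maxnC; congr (_ - _).
by have [->|] := eqVneq i j; rewrite ?eqxx// mulr0n mulr0n.
Qed.

Lemma spectral_norm_markov (R : realType) (x : nat -> nat -> R) (m b : R) n :
  (1 < n)%N -> (forall v : 'rV[R]_n, `|dev_form x m v| <= b * sqnorm v) ->
  `|spectral_norm (markov_mx x n) - `|m| * n%:R| <= b.
Proof.
case: n => [//|[//|n]] _ dev_le.
(* By Cauchy-Schwarz the form of J - n I lies between [- n * sqnorm v] and 0. *)
have form_le v : `|qform (markov_mx x n.+2) v| <= (`|m| * n.+2%:R + b) * sqnorm v.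
  rewrite (qform_markov _ m) [X in _ <= X]mulrDl.
  apply: le_trans (ler_normD _ _) _; apply: lerD => //.
  rewrite normrM -mulrA ler_wpM2l// ler0_norm ?subr_le0 ?sqnorm_row_sum//.
  by rewrite opprB gerBl sqr_ge0.
rewrite ler_distl; apply/andP; split; last first.
  exact: spectral_norm_le (markov_mx_sym x _) form_le.
(* A vector orthogonal to (1, ..., 1), on which the centered part is -m n. *)
pose u : 'rV[R]_n.+2 := delta_mx 0 0 - delta_mx 0 1.
have u0 : \sum_i u 0 i = 0.
  by rewrite 2!big_ord_recl big1 => [|i _]; rewrite !mxE/= ?eqxx; ring.
have u2 : sqnorm u = 2.
  by rewrite /sqnorm 2!big_ord_recl big1 => [|i _]; rewrite !mxE/=; ring.
have := qform_le_spectral_norm (markov_mx_sym x _) form_le u.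
have := dev_le u.
rewrite (qform_markov _ m) u0 expr0n/= sub0r u2 => dev_u norm_u.
(* Reverse triangle inequality at [u]; since [sqnorm u = 2], halving it gives the lower bound on the
   norm. *)
have : `|m| * n.+2%:R * 2 <=
    `|m * - (n.+2%:R * 2) + dev_form x m u| + `|dev_form x m u|.
  have -> : `|m| * n.+2%:R * 2 = `|m * - (n.+2%:R * 2)|.
    by rewrite mulrN normrN !normrM !normr_nat mulrA.
  rewrite -[X in `|X| <= _](addrK (dev_form x m u)) -[X in _ <= _ + X]normrN.
  exact: ler_normD.
by lra.
Qed.

(** * Interpolation between consecutive squares *)

Definition row_sum_pow4 (R : realType) (y : nat -> nat -> R) (n : nat) : R :=
  \sum_(i < n) (\sum_(j < n) y i j) ^+ 4.

(** Bounds the fourth power of every sum of [y i j] over a segment of columns between k^2 and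
    (k+1)^2: such a segment has at most 2k+1 terms, whence the factor from [sum_pow4_le]. *)
Definition gap_pow4 (R : realType) (y : nat -> nat -> R) (k : nat) : R :=
  (2 * k + 1)%:R ^+ 3 *
  \sum_(i < k.+1 ^ 2) \sum_(k ^ 2 <= j < k.+1 ^ 2) y i j ^+ 4.

(* Controls the Markov matrices of all sizes between k^2 and (k+1)^2. *)
Definition fluctuation (R : realType) (y : nat -> nat -> R) (k : nat) : R :=
  wedge_sum y (k.+1 ^ 2) + row_sum_pow4 y (k.+1 ^ 2) + gap_pow4 y k.

Lemma pow4_ge0 (R : realDomainType) (x : R) : 0 <= x ^+ 4.
Proof. by rewrite (exprM x 2 2) sqr_ge0. Qed.

Lemma ler_pow4 (R : realDomainType) (x y : R) :
  0 <= y -> x ^+ 4 <= y ^+ 4 -> `|x| <= y.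
Proof.
move=> y0 xy; rewrite -(@ler_pXn2r _ 4)// ?nnegrE//.
by rewrite -normrX ger0_norm ?pow4_ge0.
Qed.

Lemma pow4B_le (R : realFieldType) (a b : R) :
  (a - b) ^+ 4 <= 8 * (a ^+ 4 + b ^+ 4).
Proof.
rewrite -subr_ge0.
(* The constant 8 is sharp at [a = - b], so the difference has the factor [(a + b) ^+ 2]. *)
have -> : 8 * (a ^+ 4 + b ^+ 4) - (a - b) ^+ 4 =
  (a + b) ^+ 2 * (5 * (a - b) ^+ 2 + 2 * (a ^+ 2 + b ^+ 2)) by ring.
rewrite mulr_ge0 ?sqr_ge0// addr_ge0 ?(mulr_ge0 _ (sqr_ge0 _))//.
by rewrite mulr_ge0 ?addr_ge0 ?sqr_ge0.
Qed.

Lemma wedge_sum_ge0 (R : realType) (y : nat -> nat -> R) n : 0 <= wedge_sum y n.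
Proof. by apply: sumr_ge0 => i _; apply: sumr_ge0 => j _; exact: sqr_ge0. Qed.

Lemma row_sum_pow4_ge0 (R : realType) (y : nat -> nat -> R) n :
  0 <= row_sum_pow4 y n.
Proof. by apply: sumr_ge0 => i _; exact: pow4_ge0. Qed.

Lemma gap_pow4_ge0 (R : realType) (y : nat -> nat -> R) k : 0 <= gap_pow4 y k.
Proof.
rewrite mulr_ge0 ?exprn_ge0//.
by apply: sumr_ge0 => i _; apply: sumr_ge0 => j _; exact: pow4_ge0.
Qed.

Lemma fluctuation_ge0 (R : realType) (y : nat -> nat -> R) k :
  0 <= fluctuation y k.
Proof. by rewrite !addr_ge0 ?wedge_sum_ge0 ?row_sum_pow4_ge0 ?gap_pow4_ge0. Qed.

(** The partial sum is the full row sum up to (k+1)^2 minus a short tail. With [pow4B_le] its fourth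
    power is at most [8 * d ^+ 4], below [(2 * d) ^+ 4]. *)
Lemma partial_row_sum_le (R : realType) (y : nat -> nat -> R) (d : R) k n i :
  (k ^ 2 <= n <= k.+1 ^ 2)%N -> (i < k.+1 ^ 2)%N -> 0 <= d ->
  fluctuation y k <= d ^+ 4 -> `|\sum_(j < n) y i j| <= 2 * d.
Proof.
move=> /andP[kn nN] iN d0 W_le; set N := (k.+1 ^ 2)%N in nN iN W_le *.
apply: ler_pow4; first by rewrite mulr_ge0.
pose S := \sum_(j < N) y i j; pose U := \sum_(n <= j < N) y i j.
have -> : \sum_(j < n) y i j = S - U.
  rewrite /S /U -!(big_mkord xpredT (fun j => y i j)).
  by rewrite (big_cat_nat (leq0n n) nN)/= addrK.
have S_le : S ^+ 4 <= row_sum_pow4 y N.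
  rewrite /row_sum_pow4 (bigD1 (Ordinal iN))//= lerDl.
  by apply: sumr_ge0 => j _; exact: pow4_ge0.
have U_le : U ^+ 4 <= gap_pow4 y k.
  apply: le_trans (sum_pow4_le _ _) _; rewrite size_iota.
  apply: ler_pM.
  - by rewrite exprn_ge0.
  - by apply: sumr_ge0 => j _; exact: pow4_ge0.
  - by rewrite ler_pXn2r ?nnegrE// ler_nat /N; lia.
  (* The tail is enlarged to start at k^2, independently of [n], and then row [i] is enlarged to all
     rows. *)
  apply: le_trans (_ : \sum_(k ^ 2 <= j < N) y i j ^+ 4 <= _).
    rewrite [leRHS](big_cat_nat kn nN)/= lerDr.
    by apply: sumr_ge0 => j _; exact: pow4_ge0.
  rewrite [leRHS](bigD1 (Ordinal iN))//= lerDl.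
  by apply: sumr_ge0 => l _; apply: sumr_ge0 => j _; exact: pow4_ge0.
apply: le_trans (pow4B_le _ _) _.
have := wedge_sum_ge0 y N; move: W_le; rewrite /fluctuation -/N exprMn.
have := pow4_ge0 d.
by move: S_le U_le; lra.
Qed.

(** The constant 3 is 1 for the form of Y plus 2 for its row sums. *)
Lemma dev_form_le (R : realType) (x : nat -> nat -> R) (m d : R) k n
    (v : 'rV[R]_n) : (k ^ 2 <= n <= k.+1 ^ 2)%N -> 0 <= d ->
  fluctuation (sym_dev x m) k <= d ^+ 4 ->
  `|dev_form x m v| <= 3 * d * sqnorm v.
Proof.
move=> knN d0 W_le; have /andP[_ nN] := knN.
have q_le : `|qform (\matrix_(i, j) sym_dev x m i j) v| <= d * sqnorm v.
  apply: ler_pow4; first by rewrite mulr_ge0// sqnorm_ge0.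
  apply: le_trans (pow4_qform_le _ _ nN) _.
  rewrite exprMn ler_wpM2r ?pow4_ge0// (le_trans _ W_le)// /fluctuation -addrA.
  by rewrite lerDl addr_ge0 ?row_sum_pow4_ge0 ?gap_pow4_ge0.
have r_le : `|\sum_i v 0 i ^+ 2 * \sum_(j < n) sym_dev x m i j| <=
    2 * d * sqnorm v.
  apply: le_trans (ler_norm_sum _ _ _) _.
  rewrite /sqnorm mulr_sumr; apply: ler_sum => i _.
  rewrite normrM ger0_norm ?sqr_ge0// mulrC ler_wpM2r ?sqr_ge0//.
  by apply: partial_row_sum_le knN _ d0 W_le; exact: leq_trans (ltn_ord i) nN.
by apply: le_trans (ler_normB _ _) _; lra.
Qed.

Lemma sqrt_bracket n : exists k : nat, (k ^ 2 <= n < k.+1 ^ 2)%N.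
Proof.
elim: n => [|n [k /andP[kn nk]]]; first by exists 0%N.
have [lt|ge] := ltnP n.+1 (k.+1 ^ 2); first by exists k; lia.
by exists k.+1; apply/andP; split; [lia | nia].
Qed.

Lemma cvg_spectral_norm_markov (R : realType) (x : nat -> nat -> R) (m : R) :
  (fun k => fluctuation (sym_dev x m) k / (k.+1 ^ 2)%:R ^+ 4) @ \oo --> (0 : R) ->
  (fun n => spectral_norm (markov_mx x n) / n%:R) @ \oo --> `|m|.
Proof.
move=> W0; apply/cvgrPdist_le => e e0.
(* The error will be [3 * d] times (k+1)^2, and (k+1)^2 is at most 4n. *)
pose d := e / 12; have d0 : 0 < d by rewrite divr_gt0.
have /cvgrPdist_le/(_ _ (exprn_gt0 4 d0))[K _ K_le] := W0.
(* This threshold forces [K < k], so [k] is positive and the hypothesis applies at [k]; it also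
   gives [1 < n]. *)
exists (K.+2 ^ 2)%N => // n /= Kn.
have [k /andP[kn nk]] := sqrt_bracket n.
have Kk : (K < k)%N.
  by rewrite ltnNge; apply/negP => kK; have : (k.+1 ^ 2 <= K.+2 ^ 2)%N; nia.
have n1 : (1 < n)%N by apply: leq_trans Kn; nia.
have := K_le k (ltnW Kk); rewrite sub0r normrN ger0_norm; last first.
  by rewrite divr_ge0 ?fluctuation_ge0// exprn_ge0.
rewrite ler_pdivrMr ?exprn_gt0 ?ltr0n// -exprMn => W_le.
have knN : (k ^ 2 <= n <= k.+1 ^ 2)%N by rewrite kn ltnW.
have dN0 : 0 <= d * (k.+1 ^ 2)%:R by rewrite mulr_ge0// ltW.
have := spectral_norm_markov n1 (fun v => dev_form_le v knN dN0 W_le).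
have n0 : 0 < n%:R :> R by rewrite ltr0n (ltn_trans _ n1).
move=> norm_le.
have -> : `|m| - spectral_norm (markov_mx x n) / n%:R =
    - ((spectral_norm (markov_mx x n) - `|m| * n%:R) / n%:R).
  by field; rewrite gt_eqF.
rewrite normrN normrM normfV (gtr0_norm n0) ler_pdivrMr//.
apply: le_trans norm_le _.
have : (k.+1 ^ 2)%:R <= 4 * n%:R :> R by rewrite -natrM ler_nat; nia.
by rewrite /d; nra.
Qed.

(** * Independence and expectation of products *)

(** Both sides are finite measures in [E] that agree on the generating events; these are stable
    under intersection, so the measures agree on the generated sigma-algebra. *)
Lemma independent_sigma (R : realType) d (T : measurableType d)
    (P : probability T R) (I : eqType) (D : set I) (X : I -> {RV P >-> R})
    (a : I) (s : seq I) (A : set R) :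
  mutually_independent D X -> D a -> [set` s] `<=` D -> a \notin s ->
  measurable A ->
  forall E, <<s [set E | exists2 B : I -> set R, (forall i, measurable (B i)) &
                 E = \bigcap_(i in [set` s]) (X i @^-1` B i)] >> E ->
  P (X a @^-1` A `&` E) = (P (X a @^-1` A) * P E)%E.
Proof.
move=> indep Da sD aNs mA; set G := [set E | _].
have mX i B : measurable B -> measurable (X i @^-1` B).
  by move=> mB; rewrite -[_ @^-1` _]setTI; exact: measurable_funPT.
have mG : G `<=` measurable.
  by move=> _ [B mB ->]; apply: fin_bigcap_measurable => // i _; exact: mX.
have indepG E : G E -> P (X a @^-1` A `&` E) = (P (X a @^-1` A) * P E)%E.
  move=> [B mB ->].
  (* Independence is stated for lists without repetition and one family of sets, hence [undup s] and
     the override of [B] at [a]. *)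
  have sU : [set` s] = [set` undup s].
    by apply/seteqP; split => i /=; rewrite mem_undup.
  pose B' i := if i == a then A else B i.
  have B'E i : i \in undup s -> B' i = B i.
    by rewrite mem_undup /B' => si; case: eqP => // ia; rewrite -ia si in aNs.
  have mB' i : measurable (B' i) by rewrite /B'; case: ifP.
  have Ba : B' a = A by rewrite /B' eqxx.
  have := indep (a :: undup s) B'.
  rewrite /= mem_undup aNs undup_uniq => /(_ erefl).
  rewrite big_cons Ba.
  have -> : \bigcap_(i in [set` a :: undup s]) (X i @^-1` B' i) =
      X a @^-1` A `&` \bigcap_(i in [set` s]) (X i @^-1` B i).
    rewrite sU; apply/seteqP; split => w /=.
      move=> h; split; first by have := h a (mem_head _ _); rewrite Ba.
      by move=> i /= si; rewrite -(B'E _ si); apply: h; rewrite /= inE si orbT.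
    move=> [wA wB] i /=; rewrite inE => /predU1P[->|si]; first by rewrite Ba.
    by rewrite B'E//; exact: wB.
  have -> : (\prod_(j <- undup s) P (X j @^-1` B' j) =
      P (\bigcap_(i in [set` s]) (X i @^-1` B i)))%E.
    rewrite sU indep ?undup_uniq// -?sU//.
    by rewrite big_seq [RHS]big_seq; apply: eq_bigr => j js; rewrite B'E.
  apply => //; move=> i /=; rewrite inE => /predU1P[->//|].
  by rewrite mem_undup => si; exact: sD.
have pfin : (0 <= fine (P (X a @^-1` A)))%R by rewrite fine_ge0.
move=> E sGE.
have m1E F : mrestr P (mX a A mA) F = P (X a @^-1` A `&` F).
  by rewrite /mrestr setIC.
have m2E F : mscale (NngNum pfin) P F = (P (X a @^-1` A) * P F)%E.
  by rewrite /mscale/= fineK// fin_num_measure//; exact: (mX a A mA).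
rewrite -m1E -m2E.
apply: (@g_sigma_algebra_measure_unique _ R T G mG (fun=> setT)) => //.
- move=> _; exists (fun=> setT) => //.
  by apply/seteqP; split => // w _ i _.
- by apply/seteqP; split => // w _; exists 0%N.
- move=> _ _ [B mB ->] [C mC ->]; exists (fun i => B i `&` C i).
    by move=> i; exact: measurableI.
  apply/seteqP; split => [w [wB wC] i si|w h].
    by split; [exact: wB | exact: wC].
  by split => i si; have [] := h i si.
- by move=> F GF; rewrite [LHS]m1E [RHS]m2E indepG.
- move=> _; rewrite [X in (X < _)%E]m1E setIT -ge0_fin_numE//.
  by rewrite fin_num_measure//; exact: (mX a A mA).
Qed.

(* The hypothesis on h expresses its measurability in a form that applies to the
   sigma-algebra generated by X b, X c and X e. *)
Lemma independent_measurable (R : realType) d (T : measurableType d)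
    (P : probability T R) (I : eqType) (D : set I) (X : I -> {RV P >-> R})
    (a b c e : I) (h : R -> R -> R -> R) :
  mutually_independent D X -> D a -> D b -> D c -> D e -> a \notin [:: b; c; e] ->
  (forall d' (T' : measurableType d') (u v w : T' -> R),
    measurable_fun setT u -> measurable_fun setT v -> measurable_fun setT w ->
    measurable_fun setT (fun x => h (u x) (v x) (w x))) ->
  forall A B, measurable A -> measurable B ->
  P (X a @^-1` A `&` (fun w => h (X b w) (X c w) (X e w)) @^-1` B) =
  (P (X a @^-1` A) * P ((fun w => h (X b w) (X c w) (X e w)) @^-1` B))%E.
Proof.
move=> indep Da Db Dc De aN mh A B mA mB.
have sD : [set` [:: b; c; e]] `<=` D.
  by move=> i /=; rewrite !inE => /or3P[] /eqP ->.
apply: (independent_sigma indep Da sD aN mA).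
set G := [set E | _].
(* The preimage of [C] is the generator whose other sides are the whole line. *)
have mX i : i \in [:: b; c; e] ->
    measurable_fun setT (X i : g_sigma_algebraType G -> R).
  move=> si _ C mC; rewrite setTI; apply: sub_sigma_algebra.
  exists (fun j => if j == i then C else setT); first by move=> j; case: ifP.
  apply/seteqP; split => w /=.
    by move=> wC j _ /=; case: eqP => [->|].
  by move=> /(_ i si)/=; rewrite eqxx.
have := mh _ (g_sigma_algebraType G) _ _ _ (mX b _) (mX c _) (mX e _).
rewrite !inE !eqxx !orbT => /(_ erefl erefl erefl measurableT _ mB).
by rewrite setTI.
Qed.

Lemma integralM_indep0 (R : realType) d (T : measurableType d)
    (P : probability T R) (u v : T -> R) :
  measurable_fun setT u -> measurable_fun setT v ->
  (forall A B, measurable A -> measurable B ->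
    P (u @^-1` A `&` v @^-1` B) = (P (u @^-1` A) * P (v @^-1` B))%E) ->
  P.-integrable setT (EFin \o u) -> (\int[P]_w (u w)%:E = 0)%E ->
  P.-integrable setT (fun w => (u w * v w)%:E) ->
  (\int[P]_w (u w * v w)%:E = 0)%E.
Proof.
move=> mu mv indep iU EU iUV.
pose Um := isMeasurableFun.Build _ _ _ _ _ mu.
pose U : {mfun T >-> R} := MeasurableFun.Pack (MeasurableFun.Class Um).
pose Vm := isMeasurableFun.Build _ _ _ _ _ mv.
pose V : {mfun T >-> R} := MeasurableFun.Pack (MeasurableFun.Class Vm).
have mUV : measurable_fun setT (fun w => (u w, v w)).
  exact/measurable_fun_pairP.
pose UVm := isMeasurableFun.Build _ _ _ _ _ mUV.
pose UV : {mfun T >-> (R * R)%type} := MeasurableFun.Pack (MeasurableFun.Class UVm).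
pose f (z : R * R) := (z.1 * z.2)%:E.
have mf : measurable_fun [set: R * R] f.
  by apply/measurable_EFinP; apply: measurable_funM;
    [exact: measurable_fst | exact: measurable_snd].
(* By independence the joint law agrees with the product of the marginals on rectangles, hence
   everywhere. *)
have prodE := @product_measure_unique _ _ _ _ R
  (distribution P U) (distribution P V) (distribution P UV) indep.
have -> : (\int[P]_w (u w * v w)%:E = \int[distribution P UV]_z f z)%E.
  by rewrite integral_distribution.
have -> : (\int[distribution P UV]_z f z =
    \int[distribution P U \x distribution P V]_z f z)%E.
  by apply: eq_measure_integral => A mA _; exact/esym/prodE.
(* Fubini, integrating over the first variable first; integrability is transported from [iUV]
   through the equality of laws. *)
rewrite -integral21_prod_meas1; last first.
  apply/integrableP; split => //.
  have -> : (\int[distribution P U \x distribution P V]_z `|f z| =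
      \int[distribution P UV]_z `|f z|)%E.
    by apply: eq_measure_integral => A mA _; exact: prodE.
  rewrite ge0_integral_distribution//; last exact: measurableT_comp.
  by have /integrableP[] := iUV.
(* For fixed [y] the inner integral is [y] times the mean of [u]. *)
rewrite integral0_eq// => y _; rewrite /fubini_G /f/=.
under eq_integral do rewrite EFinM muleC.
have iU' : (distribution P U).-integrable setT EFin.
  by apply: integrable_pushforward.
rewrite integralZl// integral_distribution//.
by rewrite [X in (_ * X)%E]EU mule0.
Qed.

Lemma identical_ge0_integral (R : realType) d (T : measurableType d)
    (P : probability T R) (I : eqType) (D : set I) (X : I -> {RV P >-> R})
    (f : R -> \bar R) i j :
  identically_distributed D X -> D i -> D j -> measurable_fun setT f ->
  (forall x, 0 <= f x)%E ->
  (\int[P]_w f (X i w) = \int[P]_w f (X j w))%E.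
Proof.
move=> idX Di Dj mf f0.
rewrite -(ge0_integral_distribution (X i) mf f0).
rewrite -(ge0_integral_distribution (X j) mf f0).
by apply: eq_measure_integral => A mA _; exact: idX.
Qed.

Lemma identical_mean (R : realType) d (T : measurableType d)
    (P : probability T R) (I : eqType) (D : set I) (X : I -> {RV P >-> R}) i j :
  identically_distributed D X -> D i -> D j ->
  P.-integrable setT (EFin \o X i) -> P.-integrable setT (EFin \o X j) ->
  (\int[P]_w (X i w)%:E = \int[P]_w (X j w)%:E)%E.
Proof.
move=> idX Di Dj iXi iXj.
have mE : measurable_fun setT (@EFin R) by exact/measurable_EFinP.
rewrite -(integral_distribution mE iXi) -(integral_distribution mE iXj).
by apply: eq_measure_integral => A mA _; exact: idX.
Qed.

(** * Bounds on means *)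

(** Integrability is bundled with the bound so that bounds can be added and scaled. *)
Definition mean_le (R : realType) d (T : measurableType d)
    (P : probability T R) (f : T -> R) (c : R) : Prop :=
  P.-integrable setT (EFin \o f) /\ (\int[P]_w (f w)%:E <= c%:E)%E.

Lemma mean_leW (R : realType) d (T : measurableType d)
    (P : probability T R) (f : T -> R) (b c : R) :
  mean_le P f b -> b <= c -> mean_le P f c.
Proof. by move=> [fi fb] bc; split => //; rewrite (le_trans fb)// lee_fin. Qed.

Lemma mean_le_dominated (R : realType) d (T : measurableType d)
    (P : probability T R) (f g : T -> R) (c : R) :
  measurable_fun setT f -> (forall w, `|f w| <= g w) -> mean_le P g c ->
  mean_le P f c.
Proof.
move=> mf fg [gi gc].
have fi : P.-integrable setT (EFin \o f).
  apply: le_integrable gi => //; first exact/measurable_EFinP.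
  by move=> w _; rewrite /= lee_fin (le_trans (fg w))// ler_norm.
split => //; apply: le_trans gc; apply: le_integral => // w _.
by rewrite lee_fin (le_trans (ler_norm _)).
Qed.

Lemma mean_le_cst (R : realType) d (T : measurableType d)
    (P : probability T R) (c : R) : mean_le P (fun=> c) c.
Proof.
split; first exact: finite_measure_integrable_cst.
by rewrite integral_cst//= probability_setT mule1.
Qed.

Lemma mean_leD (R : realType) d (T : measurableType d)
    (P : probability T R) (f g : T -> R) (b c : R) :
  mean_le P f b -> mean_le P g c -> mean_le P (fun w => f w + g w) (b + c).
Proof.
move=> [fi fb] [gi gc]; split; first exact: (integrableD measurableT fi gi).
under eq_integral do rewrite EFinD.
by rewrite integralD//= EFinD leeD.
Qed.

Lemma mean_leZ (R : realType) d (T : measurableType d)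
    (P : probability T R) (f : T -> R) (b k : R) :
  0 <= k -> mean_le P f b -> mean_le P (fun w => k * f w) (k * b).
Proof.
move=> k0 [fi fb]; split; first exact: (integrableZl measurableT k fi).
under eq_integral do rewrite EFinM.
by rewrite integralZl//= EFinM lee_wpmul2l.
Qed.

Lemma mean_le_sum (R : realType) d (T : measurableType d)
    (P : probability T R) I (r : seq I) (f : I -> T -> R) (c : I -> R) :
  (forall i, mean_le P (f i) (c i)) ->
  mean_le P (fun w => \sum_(i <- r) f i w) (\sum_(i <- r) c i).
Proof.
move=> fc; elim: r => [|i r IHr].
  rewrite big_nil (_ : (fun w => _) = cst 0).
    by split; [exact: integrable0 | rewrite integral0].
  by apply/funext => w; rewrite big_nil.
rewrite big_cons (_ : (fun w => _) = fun w => f i w + \sum_(i <- r) f i w).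
  exact: mean_leD (fc i) IHr.
by apply/funext => w; rewrite big_cons.
Qed.

(** The series of the [f k] has finite mean, so it converges almost surely and its terms tend to
    0. *)
Lemma cvg0_of_summable_mean (R : realType) d (T : measurableType d)
    (P : probability T R) (f : nat -> T -> R) (c : R) :
  0 <= c -> (forall k w, 0 <= f k w) ->
  (forall k, mean_le P (f k) (c / (k.+1 ^ 2)%:R)) ->
  {ae P, forall w, (fun k => f k w) @ \oo --> (0 : R)}.
Proof.
move=> c0 f0 fc.
have mf k : measurable_fun setT (EFin \o f k) by exact: measurable_int (fc k).1.
(* A telescoping majorant, as 1/(n+1)^2 is at most 2/(n+1) - 2/(n+2). *)
have sum_le n : \sum_(0 <= k < n) c / (k.+1 ^ 2)%:R <= 2 * c - 2 * c / n.+1%:R.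
  elim: n => [|n IHn]; first by rewrite big_geq// divr1 subrr.
  rewrite big_nat_recr//=; apply: le_trans (lerD IHn (lexx _)) _.
  rewrite -subr_ge0.
  have -> : 2 * c - 2 * c / n.+2%:R - (2 * c - 2 * c / n.+1%:R + c / (n.+1 ^ 2)%:R)
     = c * n%:R / (n.+1%:R ^+ 2 * n.+2%:R).
    by rewrite natrX -!natr1; field; rewrite !natr1 !pnatr_eq0.
  by rewrite divr_ge0// ?mulr_ge0// exprn_ge0.
have int_lt : (\int[P]_w (\sum_(k <oo) (f k w)%:E) < +oo)%E.
  rewrite integral_nneseries//; last by move=> k w _; rewrite lee_fin.
  apply: le_lt_trans (ltry (2 * c)).
  apply: lime_le.
    apply: is_cvg_nneseries => k _ _.
    by rewrite integral_ge0// => w _; rewrite lee_fin.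
  apply: nearW => n.
  apply: le_trans (_ : (\sum_(0 <= k < n) c / (k.+1 ^ 2)%:R)%:E <= _)%E.
    by rewrite -sumEFin; apply: lee_sum => k _; exact: (fc k).2.
  by rewrite lee_fin (le_trans (sum_le n))// gerBl divr_ge0 ?mulr_ge0.
have mS : measurable_fun setT (fun w => \sum_(k <oo) (f k w)%:E)%E.
  have h0 k w : setT w -> xpredT k -> (0 <= (EFin \o f k) w)%E by rewrite lee_fin.
  exact: (@ge0_emeasurable_sum _ _ R setT _ xpredT h0 (fun k _ => mf k)).
have S0 w : (0 <= \sum_(k <oo) (f k w)%:E)%E.
  by apply: nneseries_ge0 => k _ _; rewrite lee_fin.
have /integrable_ae : P.-integrable setT (fun w => \sum_(k <oo) (f k w)%:E)%E.
  apply/integrableP; split => //; under eq_integral do rewrite gee0_abs//.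
  exact: int_lt.
move=> /(_ measurableT); apply: filterS => w /(_ I) fin.
apply: cvg_series_cvg_0; apply: nondecreasing_is_cvgn.
  by apply: nondecreasing_series => k _ _.
exists (fine (\sum_(k <oo) (f k w)%:E)%E) => _ [n _ <-].
rewrite -lee_fin fineK// /series/= -sumEFin.
by apply: nneseries_lim_ge => k _ _; rewrite lee_fin.
Qed.

(** * Fourth mixed moments *)

Definition paired (I : eqType) (a b c e : I) : bool :=
  [|| (a == b) && (c == e), (a == c) && (b == e) | (a == e) && (b == c)].

(** By contraposition: if each index equals another one, the four equalities already force two equal
    pairs. *)
Lemma unpaired_isolated (I : eqType) (a b c e : I) : ~~ paired a b c e ->
  [|| a \notin [:: b; c; e], b \notin [:: a; c; e],
      c \notin [:: a; b; e] | e \notin [:: a; b; c]].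
Proof.
apply: contraNT; rewrite !negb_or/= !negb_and !negbK/= !orbF => /and4P[].
by do 4 (move=> /or3P[] /eqP E; rewrite ?E {E}); rewrite /paired !eqxx ?orbT.
Qed.

Lemma centered_prod_mean0 (R : realType) d (T : measurableType d)
    (P : probability T R) (I : eqType) (D : set I) (X : I -> {RV P >-> R})
    (m : R) (a b c e : I) :
  mutually_independent D X -> D a -> D b -> D c -> D e -> a \notin [:: b; c; e] ->
  P.-integrable setT (EFin \o X a) -> (\int[P]_w (X a w)%:E = m%:E)%E ->
  P.-integrable setT
    (fun w => ((X a w - m) * ((X b w - m) * (X c w - m) * (X e w - m)))%:E) ->
  (\int[P]_w ((X a w - m) * ((X b w - m) * (X c w - m) * (X e w - m)))%:E = 0)%E.
Proof.
move=> indep Da Db Dc De aN iXa EXa iprod.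
have mB d' (T' : measurableType d') (u : T' -> R) : measurable_fun setT u ->
    measurable_fun setT (fun x => u x - m).
  by move=> mu; exact: measurable_funB.
pose h u v w : R := (u - m) * (v - m) * (w - m).
have mh d' (T' : measurableType d') (u v w : T' -> R) :
    measurable_fun setT u -> measurable_fun setT v -> measurable_fun setT w ->
    measurable_fun setT (fun x => h (u x) (v x) (w x)).
  by move=> mu mv mw; apply: measurable_funM; [apply: measurable_funM|]; exact: mB.
have im : P.-integrable setT (fun=> m%:E) by exact: finite_measure_integrable_cst.
apply: (@integralM_indep0 _ _ _ P (fun w => X a w - m)
  (fun w => h (X b w) (X c w) (X e w))) => //.
- exact: mB.
- exact: mh.
- move=> A B mA mBB.
  (* The shift by [m] is moved from the variable [X a] into the set [A]. *)
  apply: (@independent_measurable _ _ _ _ _ _ _ _ _ _ _ _ indep Da Db Dc De aN mh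
    ((fun x => x - m) @^-1` A)) => //.
  by rewrite -[_ @^-1` _]setTI; exact: mB.
- exact: (integrableB measurableT iXa im).
- under eq_integral do rewrite EFinB.
  by rewrite integralB//= EXa integral_cst//= probability_setT mule1 subee.
Qed.

Lemma amgm4 (R : realFieldType) (a b c e : R) :
  `|a * b * c * e| <= 4^-1 * (a ^+ 4 + b ^+ 4 + c ^+ 4 + e ^+ 4).
Proof.
have two (x y : R) : `|x * y| <= 2^-1 * (x ^+ 2 + y ^+ 2).
  have p : 0 <= (x - y) ^+ 2 := sqr_ge0 _.
  have q : 0 <= (x + y) ^+ 2 := sqr_ge0 _.
  by rewrite ler_norml; move: p q; rewrite sqrrB sqrrD -mulr_natl; lra.
rewrite -mulrA normrM.
apply: le_trans (_ : 2^-1 * (`|a * b| ^+ 2 + `|c * e| ^+ 2) <= _).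
  have := two `|a * b| `|c * e|; apply: le_trans; exact: ler_norm.
rewrite !real_normK ?num_real//.
have := le_trans (ler_norm _) (two (a ^+ 2) (b ^+ 2)).
have := le_trans (ler_norm _) (two (c ^+ 2) (e ^+ 2)).
by rewrite -!exprM !exprMn; lra.
Qed.

(** [amgm4] gives integrability and the bound [K] in all cases; without a pairing some factor is
    isolated, and independence makes the mean vanish. *)
Lemma mean_le_prod4 (R : realType) d (T : measurableType d)
    (P : probability T R) (I : eqType) (D : set I) (X : I -> {RV P >-> R})
    (m K : R) (a b c e : I) :
  mutually_independent D X ->
  (forall i, D i -> P.-integrable setT (EFin \o X i)) ->
  (forall i, D i -> \int[P]_w (X i w)%:E = m%:E)%E ->
  (forall i, D i -> mean_le P (fun w => (X i w - m) ^+ 4) K) ->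
  D a -> D b -> D c -> D e ->
  mean_le P (fun w => (X a w - m) * (X b w - m) * (X c w - m) * (X e w - m))
    (if paired a b c e then K else 0).
Proof.
move=> indep iX EX K4 Da Db Dc De.
set f := fun w => _.
pose g w := 4^-1 * ((X a w - m) ^+ 4 + (X b w - m) ^+ 4 + (X c w - m) ^+ 4 +
  (X e w - m) ^+ 4).
have gK : mean_le P g K.
  have := mean_leD (mean_leD (mean_leD (K4 _ Da) (K4 _ Db)) (K4 _ Dc)) (K4 _ De).
  have q0 : 0 <= 4^-1 :> R by rewrite invr_ge0.
  by move=> /(mean_leZ q0)/mean_leW; apply; lra.
have mY i : measurable_fun setT (fun w => X i w - m) by exact: measurable_funB.
have mf : measurable_fun setT f.
  by do 3 apply: measurable_funM => //.
have fg w : `|f w| <= g w by exact: amgm4.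
have fK := mean_le_dominated mf fg gK.
case: ifPn => [//|/unpaired_isolated isolated]; split; first exact: fK.1.
(* The isolated factor is moved to the front, which treats its four positions at once. *)
suff perm x y z t : D x -> D y -> D z -> D t -> x \notin [:: y; z; t] ->
    (forall w, f w = (X x w - m) * ((X y w - m) * (X z w - m) * (X t w - m))) ->
    (\int[P]_w (f w)%:E <= 0)%E.
  case/or4P: isolated => [/perm|/perm|/perm|/perm]; apply => // w; rewrite /f; ring.
move=> Dx Dy Dz Dt xN fE.
have fE' : f = fun w => (X x w - m) * ((X y w - m) * (X z w - m) * (X t w - m)).
  exact/funext.
by rewrite fE' (centered_prod_mean0 indep Dx Dy Dz Dt xN)//; [exact: iX|exact: EX|
  rewrite -[X in P.-integrable _ X]/(EFin \o (fun w => _)) -fE'; exact: fK.1].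
Qed.

(** * Means of the fluctuations *)

(** Sorted, because Y_ij and Y_ji are the same random variable. *)
Definition edge (i j : nat) : nat * nat := (minn i j, maxn i j).

Lemma sum_delta (R : realType) n (j : 'I_n) : \sum_(i < n) (i == j)%:R = 1 :> R.
Proof. by rewrite (bigD1 j)//= eqxx big1 ?addr0// => i /negbTE ->. Qed.

(** Each alternative removes one of four free indices, so at most 3 n^3 terms have nonzero mean. *)
Lemma paired_wedge i i' j l :
  paired (edge i j) (edge i l) (edge i' j) (edge i' l) ->
  [|| j == l, i == i' | i == l].
Proof. by rewrite /paired /edge !xpair_eqE; lia. Qed.

(** Edges with a common end [i] coincide only if their other ends do; this leaves [i] and two more
    free indices. *)
Lemma paired_star i a b c e :
  paired (edge i a) (edge i b) (edge i c) (edge i e) -> paired a b c e.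
Proof. by rewrite /paired /edge !xpair_eqE; lia. Qed.

Lemma sumr_cst_ord (R : realType) n (c : R) : \sum_(i < n) c = n%:R * c.
Proof. by rewrite sumr_const card_ord mulr_natl. Qed.

Lemma mean_le_wedge_sum (R : realType) d (T : measurableType d)
    (P : probability T R) (y : T -> nat -> nat -> R) (K : R) n : 0 <= K ->
  (forall i1 j1 i2 j2 i3 j3 i4 j4,
    mean_le P (fun w => y w i1 j1 * y w i2 j2 * y w i3 j3 * y w i4 j4)
      (if paired (edge i1 j1) (edge i2 j2) (edge i3 j3) (edge i4 j4)
       then K else 0)) ->
  mean_le P (fun w => wedge_sum (y w) n) (3 * K * n%:R ^+ 3).
Proof.
move=> K0 yK.
have -> : (fun w => wedge_sum (y w) n) = fun w =>
    \sum_(j < n) \sum_(l < n) \sum_(i < n) \sum_(i' < n)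
      y w i j * y w i l * y w i' j * y w i' l.
  apply/funext => w; apply: eq_bigr => j _; apply: eq_bigr => l _.
  rewrite expr2 mulr_suml; apply: eq_bigr => i _.
  by rewrite mulr_sumr; apply: eq_bigr => i' _; rewrite !mulrA.
have := mean_le_sum (index_enum 'I_n) (fun j : 'I_n =>
  mean_le_sum (index_enum 'I_n) (fun l : 'I_n =>
  mean_le_sum (index_enum 'I_n) (fun i : 'I_n =>
  mean_le_sum (index_enum 'I_n) (fun i' : 'I_n => yK i j i l i' j i' l)))).
move/mean_leW; apply.
(* The condition is replaced by a sum of three indicators, each of total n^3. *)
apply: le_trans (_ : \sum_(j < n) \sum_(l < n) \sum_(i < n) \sum_(i' < n)
    K * ((j == l)%:R + (i' == i)%:R + (i == l)%:R) <= _).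
  apply: ler_sum => j _; apply: ler_sum => l _.
  apply: ler_sum => i _; apply: ler_sum => i' _.
  case: ifPn => [/paired_wedge|_]; last by rewrite mulr_ge0// !addr_ge0.
  rewrite !val_eqE (eq_sym i') => h; rewrite -[leLHS]mulr1 ler_wpM2l//.
  by case/or3P: h => ->; rewrite -!natrD (ler_nat _ 1); lia.
under eq_bigr do under eq_bigr do under eq_bigr do
  rewrite -mulr_sumr !big_split/= sum_delta !sumr_cst_ord.
under eq_bigr do under eq_bigr do
  rewrite -mulr_sumr !big_split/= -!mulr_sumr sum_delta !sumr_cst_ord.
under eq_bigr => j _.
  rewrite -mulr_sumr !big_split/= -!mulr_sumr.
  under [X in _ * (_ * X)]eq_bigr do rewrite eq_sym.
  over.
under eq_bigr do rewrite sum_delta !sumr_cst_ord.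
by rewrite sumr_cst_ord le_eqVlt; apply/orP; left; apply/eqP; ring.
Qed.

Lemma mean_le_row_sum_pow4 (R : realType) d (T : measurableType d)
    (P : probability T R) (y : T -> nat -> nat -> R) (K : R) n : 0 <= K ->
  (forall i1 j1 i2 j2 i3 j3 i4 j4,
    mean_le P (fun w => y w i1 j1 * y w i2 j2 * y w i3 j3 * y w i4 j4)
      (if paired (edge i1 j1) (edge i2 j2) (edge i3 j3) (edge i4 j4)
       then K else 0)) ->
  mean_le P (fun w => row_sum_pow4 (y w) n) (3 * K * n%:R ^+ 3).
Proof.
move=> K0 yK.
have -> : (fun w => row_sum_pow4 (y w) n) = fun w =>
    \sum_(i < n) \sum_(a < n) \sum_(b < n) \sum_(c < n) \sum_(e < n)
      y w i a * y w i b * y w i c * y w i e.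
  apply/funext => w; apply: eq_bigr => i _.
  rewrite !exprS expr0 mulr1 mulr_suml; apply: eq_bigr => a _.
  rewrite mulr_suml mulr_sumr; apply: eq_bigr => b _.
  rewrite mulr_suml !mulr_sumr; apply: eq_bigr => c _.
  by rewrite !mulr_sumr; apply: eq_bigr => e _; rewrite !mulrA.
have := mean_le_sum (index_enum 'I_n) (fun i : 'I_n =>
  mean_le_sum (index_enum 'I_n) (fun a : 'I_n =>
  mean_le_sum (index_enum 'I_n) (fun b : 'I_n =>
  mean_le_sum (index_enum 'I_n) (fun c : 'I_n =>
  mean_le_sum (index_enum 'I_n) (fun e : 'I_n => yK i a i b i c i e))))).
move/mean_leW; apply.
(* One product of indicators for each of the three pairings of [a], [b], [c], [e], each of total
   n^3. *)
apply: le_trans (_ : \sum_(i < n) \sum_(a < n) \sum_(b < n) \sum_(c < n)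
    \sum_(e < n) K * ((b == a)%:R * (e == c)%:R + (c == a)%:R * (e == b)%:R +
      (e == a)%:R * (c == b)%:R) <= _).
  apply: ler_sum => i _; apply: ler_sum => a _; apply: ler_sum => b _.
  apply: ler_sum => c _; apply: ler_sum => e _.
  case: ifPn => [/paired_star|_]; last by rewrite mulr_ge0// !addr_ge0// mulr_ge0.
  rewrite /paired !val_eqE => h; rewrite -[leLHS]mulr1 ler_wpM2l//.
  rewrite -!natrM -!natrD (ler_nat _ 1) !mulnb (eq_sym b) (eq_sym c a) (eq_sym e)
    (eq_sym e) (eq_sym e) (eq_sym c b).
  by case/or3P: h => ->; lia.
under eq_bigr do under eq_bigr do under eq_bigr do under eq_bigr do
  rewrite -mulr_sumr !big_split/= -!mulr_sumr -mulr_suml !sum_delta ?mulr1 ?mul1r.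
under eq_bigr do under eq_bigr do under eq_bigr do
  rewrite -mulr_sumr !big_split/= !sumr_cst_ord !sum_delta.
under eq_bigr do under eq_bigr do
  rewrite -mulr_sumr !big_split/= -!mulr_sumr !sum_delta !sumr_cst_ord.
under eq_bigr do rewrite !sumr_cst_ord.
by rewrite sumr_cst_ord le_eqVlt; apply/orP; left; apply/eqP; ring.
Qed.

Lemma mean_le_gap_pow4 (R : realType) d (T : measurableType d)
    (P : probability T R) (y : T -> nat -> nat -> R) (K : R) k : 0 <= K ->
  (forall i j, mean_le P (fun w => y w i j ^+ 4) K) ->
  mean_le P (fun w => gap_pow4 (y w) k) (16 * K * (k.+1 ^ 2)%:R ^+ 3).
Proof.
move=> K0 yK.
have c0 : 0 <= (2 * k + 1)%:R ^+ 3 :> R by rewrite exprn_ge0.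
have := mean_leZ c0 (mean_le_sum (index_enum 'I_(k.+1 ^ 2)) (fun i =>
  mean_le_sum (index_iota (k ^ 2) (k.+1 ^ 2)) (fun j => yK (val i) j))).
move/mean_leW; apply.
rewrite sumr_cst_ord big_const_nat iter_addr_0 -(mulr_natr K).
have -> : (k.+1 ^ 2 - k ^ 2 = 2 * k + 1)%N by lia.
have -> : (2 * k + 1)%:R ^+ 3 * ((k.+1 ^ 2)%:R * (K * (2 * k + 1)%:R)) =
   K * ((2 * k + 1) ^ 4 * k.+1 ^ 2)%:R by rewrite natrM !natrX; ring.
(* The constant is 2^4, from bounding 2k+1 by 2(k+1). *)
have -> : 16 * K * (k.+1 ^ 2)%:R ^+ 3 = K * ((2 * k.+1) ^ 4 * k.+1 ^ 2)%:R.
  by rewrite natrM !natrX natrM; ring.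
rewrite ler_wpM2l// ler_nat leq_mul2r leq_exp2r//.
by apply/orP; right; lia.
Qed.

(** 22 = 3 + 3 + 16 adds up the three terms of order N^3 with N = (k+1)^2; division by N^4 leaves
    1/N, summable in [k]. *)
Lemma mean_le_fluctuation (R : realType) d (T : measurableType d)
    (P : probability T R) (y : T -> nat -> nat -> R) (K : R) k : 0 <= K ->
  (forall i1 j1 i2 j2 i3 j3 i4 j4,
    mean_le P (fun w => y w i1 j1 * y w i2 j2 * y w i3 j3 * y w i4 j4)
      (if paired (edge i1 j1) (edge i2 j2) (edge i3 j3) (edge i4 j4)
       then K else 0)) ->
  mean_le P (fun w => fluctuation (y w) k / (k.+1 ^ 2)%:R ^+ 4)
    (22 * K / (k.+1 ^ 2)%:R).
Proof.
move=> K0 yK; set N := (k.+1 ^ 2)%:R.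
have N0 : N != 0 :> R by rewrite pnatr_eq0.
have y4 i j : mean_le P (fun w => y w i j ^+ 4) K.
  have := yK i j i j i j i j; rewrite /paired !eqxx/=.
  by congr (mean_le _ _ _); apply/funext => w; ring.
have q0 : 0 <= (N ^+ 4)^-1 by rewrite invr_ge0 exprn_ge0.
have := mean_leZ q0 (mean_leD (mean_leD (mean_le_wedge_sum (k.+1 ^ 2) K0 yK)
  (mean_le_row_sum_pow4 (k.+1 ^ 2) K0 yK)) (mean_le_gap_pow4 k K0 y4)).
rewrite -/N.
under eq_fun do rewrite mulrC.
by move/mean_leW; apply; rewrite le_eqVlt; apply/orP; left; apply/eqP; field.
Qed.

(** * The almost sure limit *)

Unset Implicit Arguments.

Theorem corollary1p6 (R : realType) (d : measure_display)
    (T : measurableType d) (P : probability T R)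
    (X : nat -> nat -> {RV P >-> R}) (m : R)
    (X_iid : iid [set p : nat * nat | (p.1 <= p.2)%N] (fun p => X p.1 p.2))
    (X_mean : ('E_P[X 0%N 1%N] = m%:E)%E)
    (X_moment4 : ('E_P[fun w => (X 0%N 1%N w ^+ 4)%R] < +oo)%E) :
  {ae P, forall w,
    (fun n : nat => spectral_norm (markov_mx (fun i j => X i j w) n) / n%:R)
      @ \oo --> `|m|}.
Proof.
have [indep idX] := X_iid.
set D := [set p : nat * nat | _] in indep idX.
pose Z (p : nat * nat) := X p.1 p.2.
have D01 : D (0%N, 1%N) by [].
move: X_mean X_moment4; rewrite unlock => EX01 EX4.
have mp4 : measurable_fun setT (fun x : R => (x ^+ 4)%:E).
  by apply/measurable_EFinP; apply: measurable_funX; exact: measurable_id.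
pose c := fine (\int[P]_w (X 0%N 1%N w ^+ 4)%:E).
have X4 p : D p -> mean_le P (fun w => Z p w ^+ 4) c.
  move=> Dp.
  have x4 (x : R) : (0 <= (x ^+ 4)%:E)%E by rewrite lee_fin pow4_ge0.
  have intE : (\int[P]_w (Z p w ^+ 4)%:E = \int[P]_w (X 0%N 1%N w ^+ 4)%:E)%E.
    exact: (identical_ge0_integral idX Dp D01 mp4 x4).
  split.
    apply/integrableP; split.
      by apply/measurable_EFinP; exact: measurable_funX.
    under eq_integral do rewrite /= ger0_norm ?pow4_ge0//.
    by rewrite intE.
  rewrite intE fineK// ge0_fin_numE//; exact: integral_ge0.
have iX p : D p -> P.-integrable setT (EFin \o Z p).
  move=> Dp.
  apply: (mean_le_dominated _ _ (mean_leD (mean_le_cst P 1) (X4 p Dp))).1 => //.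
  (* AM-GM with three factors 1 bounds |z| by 1 + z^4. *)
  move=> w /=; have := amgm4 (Z p w) 1 1 1; rewrite !mulr1 !expr1n.
  by have := pow4_ge0 (Z p w); lra.
have EX p : D p -> (\int[P]_w (Z p w)%:E = m%:E)%E.
  by move=> Dp; rewrite (identical_mean idX Dp D01 (iX _ Dp) (iX _ D01)).
pose K := 8 * (c + m ^+ 4).
have Y4 p : D p -> mean_le P (fun w => (Z p w - m) ^+ 4) K.
  move=> Dp; have e8 : 0 <= 8 :> R by [].
  apply: mean_le_dominated (mean_leZ e8 (mean_leD (X4 p Dp) (mean_le_cst P (m ^+ 4)))).
    by apply: measurable_funX; exact: measurable_funB.
  by move=> w; rewrite ger0_norm ?pow4_ge0// pow4B_le.
have K0 : 0 <= K.
  rewrite mulr_ge0// addr_ge0 ?pow4_ge0// fine_ge0//.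
  by apply: integral_ge0 => w _; rewrite lee_fin pow4_ge0.
(* Sorted pairs lie in [D], so the moment bounds cover entries below the diagonal too. *)
have eD i j : D (edge i j) by rewrite /D /edge /=; lia.
have yK i1 j1 i2 j2 i3 j3 i4 j4 := mean_le_prod4 indep iX EX Y4
  (eD i1 j1) (eD i2 j2) (eD i3 j3) (eD i4 j4).
pose y w := sym_dev (fun i j => X i j w) m.
have K22 : 0 <= 22 * K by rewrite mulr_ge0.
have := cvg0_of_summable_mean K22 _ (fun k => mean_le_fluctuation (y := y) k K0 yK).
have f0 k w : 0 <= fluctuation (y w) k / (k.+1 ^ 2)%:R ^+ 4.
  by rewrite divr_ge0 ?fluctuation_ge0// exprn_ge0.
(* On the almost sure event the remaining argument is deterministic. *)
by move=> /(_ f0); apply: filterS => w; exact: cvg_spectral_norm_markov.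
Qed.
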